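(* Let $A\subset X$ be a nonempty closed subset of an arbitrary metric space $(X,d)$ and $f:A\to C$ a continuous map from $A$ to an arbitrary nonempty max-plus convex subset $C$ of $E$. Then there exists a continuous map $\hat f:X\to[\![f(A)]\!]$ whose restriction to $A$ is $f$.
   Context: $E\neq\{0\}$ is an Archimedean Riesz space (real vector lattice; Archimedean means that if $ny\leqslant x$ for all $n\in\mathbb{N}$ then $y\leqslant 0$), and $\mathbf{u}\in E_+$ is a unit: for every $x\in E_+$ there is $n\in\mathbb{N}$ with $x\leqslant n\mathbf{u}$. The topology on $E$ is that of the metric $\mathsf{D}_{\mathbf{hu}}(x,y)=\max\{0,\mathbf{p}_{\mathbf{u}}(x-y)\}+\max\{0,\mathbf{p}_{\mathbf{u}}(y-x)\}$, where $\mathbf{p}_{\mathbf{u}}(x)=\inf\{t\in\mathbb{R}:x\leqslant t\mathbf{u}\}$. The max-plus convex hull of a nonempty $S\subset E$ is the set $[\![S]\!]$ of all elements $(x_1+t_1\mathbf{u})\vee\cdots\vee(x_m+t_m\mathbf{u})$ with $m\ge1$, $x_i\in S$, $t_i\in\mathbb{R}$ and $\max_i t_i=0$; $[\![\emptyset]\!]=\emptyset$. A set $C\subset E$ is max-plus convex if $C=[\![C]\!]$. *)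

(* Defs.v *)
From HB Require Import structures.
From mathcomp Require Import all_boot all_order all_algebra.
From mathcomp Require Import all_classical all_reals all_analysis.

Set Implicit Arguments.
Unset Strict Implicit.
Unset Printing Implicit Defensive.

Import Order.TTheory GRing.Theory Num.Theory.

Local Open Scope classical_set_scope.
Local Open Scope ring_scope.

(* Riesz spaces extend the library's partially ordered Z-modules rather than
   its lattices: real domains already combine [Order.Lattice ring_display] with
   an additive structure, which prevents adding another such combination.  Meets
   are [- riesz_join (- x) (- y)]. *)
HB.mixin Record isRiesz (R : realType) E
    of Num.POrderedZmodule E & GRing.Lmodule R E := {
  riesz_leD2r : forall z x y : E, x <= y -> x + z <= y + z;
  riesz_scaler_ge0 : forall (a : R) (x : E), 0 <= a -> 0 <= x -> 0 <= a *: x;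
  riesz_join : E -> E -> E;
  riesz_leUx : forall x y z : E,
    (riesz_join x y <= z) = (x <= z) && (y <= z)
}.

#[short(type="rieszType")]
HB.structure Definition Riesz (R : realType) :=
  { E of Num.POrderedZmodule E & GRing.Lmodule R E & isRiesz R E }.

Arguments riesz_leD2r {R s} z [x y] _.
Arguments riesz_scaler_ge0 {R s} [a x] _ _.

Definition riesz_archimedean (R : realType) (E : rieszType R) : Prop :=
  forall x y : E, (forall n : nat, y *+ n <= x) -> y <= 0.

Definition riesz_unit (R : realType) (E : rieszType R) (u : E) : Prop :=
  0 <= u /\ forall x : E, 0 <= x -> exists n : nat, x <= u *+ n.

Section hu_metric.
Context {R : realType} {E : rieszType R}.
Implicit Types (u x y : E) (t : R).

(* If E is nonzero, Archimedean, and u is a unit, the set below is nonempty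
   and bounded below, so that [inf] is a genuine infimum.  If E = {0}, the set
   is all of R, and [inf] takes its default value 0. *)
Definition p_u u x : R := inf [set t : R | x <= t *: u].

Definition D_hu u x y : R :=
  Num.max 0 (p_u u (x - y)) + Num.max 0 (p_u u (y - x)).

Hypothesis archE : riesz_archimedean E.
Variable u : E.
Hypothesis unit_u : riesz_unit u.

Let lerD2l x y z : x <= y -> z + x <= z + y.
Proof. by rewrite ![z + _]addrC; exact: riesz_leD2r. Qed.

Let ler_add x y z w : x <= y -> z <= w -> x + z <= y + w.
Proof.
by move=> xy zw; apply: (le_trans (riesz_leD2r z xy)); exact: lerD2l.
Qed.

Let ler_sub0 x y : (x - y <= 0) = (x <= y).
Proof.
by apply/idP/idP => [/(riesz_leD2r y)|/(riesz_leD2r (- y))];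
  rewrite ?subrK ?add0r ?subrr.
Qed.

Let ge0_sub x y : (0 <= y - x) = (x <= y).
Proof.
by apply/idP/idP => [/(riesz_leD2r x)|/(riesz_leD2r (- x))];
  rewrite ?subrK ?add0r ?subrr.
Qed.

Let ler_scale s t : s <= t -> s *: u <= t *: u.
Proof.
move=> st; rewrite -ge0_sub -scalerBl riesz_scaler_ge0 ?subr_ge0//.
exact: unit_u.1.
Qed.

Let leUl x y : x <= riesz_join x y.
Proof. by have := lexx (riesz_join x y); rewrite riesz_leUx => /andP[]. Qed.

Let leUr x y : y <= riesz_join x y.
Proof. by have := lexx (riesz_join x y); rewrite riesz_leUx => /andP[]. Qed.

Let unit_bound x : exists n : nat, x <= n%:R *: u.
Proof.
have [n xn] := unit_u.2 (riesz_join x 0) (leUr _ _).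
by exists n; rewrite scaler_nat; apply: le_trans (leUl _ _) xn.
Qed.

Let arch_scale x s : (forall e, 0 < e -> x <= (s + e) *: u) -> x <= s *: u.
Proof.
move=> H; rewrite -ler_sub0; apply: (@archE u) => -[|n].
  by rewrite mulr0n; exact: unit_u.1.
have := H n.+1%:R^-1; rewrite invr_gt0 ltr0Sn => /(_ isT).
rewrite scalerDl => /(riesz_leD2r (- (s *: u))).
rewrite addrAC subrr add0r -ge0_sub.
move=> /(riesz_scaler_ge0 (ler0n R n.+1)).
by rewrite scalerBr scalerA divff ?pnatr_eq0// scale1r ge0_sub scaler_nat.
Qed.

Lemma unit_eq0 : u = 0 -> forall x, x = 0.
Proof.
move=> u0 x.
have le0 y : y <= 0 by have [n] := unit_bound y; rewrite u0 scaler0.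
apply/le_anti; rewrite le0/=.
by have := lerD2l x (le0 (- x)); rewrite subrr addr0.
Qed.

Lemma has_inf_p_u : u <> 0 -> forall x, has_inf [set t : R | x <= t *: u].
Proof.
move=> u0 x; split; first by have [n xn] := unit_bound x; exists n%:R.
have [n xn] := unit_bound (- x); exists (- n%:R) => t /= xt.
rewrite leNgt; apply/negP => tn; apply: u0; apply/le_anti.
rewrite unit_u.1 andbT.
have := ler_add xn xt; rewrite addNr -scalerDl => h.
have e0 : 0 < - (n%:R + t) by rewrite oppr_gt0 -ltrBrDl sub0r.
have := riesz_scaler_ge0 (ltW (etrans (invr_gt0 _) e0)) h.
rewrite scalerA invrN mulNr mulVf ?scaleN1r.
  by move=> /(riesz_leD2r u); rewrite addNr add0r.
by rewrite -oppr_eq0 gt_eqF.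
Qed.

Lemma maxp_u_le x t : 0 <= t -> (Num.max 0 (p_u u x) <= t) = (x <= t *: u).
Proof.
move=> t0; rewrite ge_max t0/=.
have [u0|/eqP u0] := eqVneq u 0.
  rewrite (unit_eq0 u0 (t *: u)) (unit_eq0 u0 x) lexx /p_u.
  have -> : [set t : R | (0 : E) <= t *: u] = setT.
    by apply/seteqP; split => // s _ /=; rewrite u0 scaler0.
  by rewrite inf_out// => -[_ [s /(_ (s - 1) I)]];
    rewrite lerBrDr gerDl ler10.
have hi := has_inf_p_u u0 x.
apply/idP/idP => [pt|xt]; last by apply: ge_inf => //; exact: hi.2.
apply: le_trans (ler_scale pt); apply: arch_scale => e e0.
have [s /= xs sp] := inf_adherent e0 hi.
by apply: le_trans xs _; apply: ler_scale; exact: ltW.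
Qed.

Let le_maxp_u x : x <= Num.max 0 (p_u u x) *: u.
Proof. by rewrite -maxp_u_le// le_max lexx. Qed.

Let maxp_u_ge0 x : 0 <= Num.max 0 (p_u u x).
Proof. by rewrite le_max lexx. Qed.

Let maxp_uD x y : Num.max 0 (p_u u (x + y)) <=
  Num.max 0 (p_u u x) + Num.max 0 (p_u u y).
Proof. by rewrite maxp_u_le ?addr_ge0// scalerDl ler_add. Qed.

Lemma D_huxx x : D_hu u x x = 0.
Proof.
rewrite /D_hu subrr; have -> : Num.max 0 (p_u u 0) = 0; last by rewrite addr0.
by apply/le_anti; rewrite maxp_u_ge0 maxp_u_le// scale0r lexx.
Qed.

Lemma D_hu_positivity x y : D_hu u x y = 0 -> x = y.
Proof.
move=> /eqP; rewrite paddr_eq0// => /andP[/eqP xy /eqP yx].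
have := le_maxp_u (x - y); have := le_maxp_u (y - x).
rewrite xy yx scale0r !ler_sub0 => yx' xy'.
by apply/le_anti; rewrite xy' yx'.
Qed.

Lemma D_hu_sym x y : D_hu u x y = D_hu u y x.
Proof. exact: addrC. Qed.

Lemma D_hu_triangle y x z : D_hu u x z <= D_hu u x y + D_hu u y z.
Proof.
rewrite /D_hu addrACA lerD//.
  by have -> : x - z = (x - y) + (y - z); [rewrite addrA subrK | exact: maxp_uD].
have -> : z - x = (y - x) + (z - y); last exact: maxp_uD.
by rewrite [RHS]addrC addrA subrK.
Qed.

End hu_metric.

(* The carrier of E, with the topology of the metric D_hu u; the two proof
   arguments make the metric axioms available to the instance. *)
Definition hu_space (R : realType) (E : rieszType R)
    (archE : riesz_archimedean E) (u : E) (unit_u : riesz_unit u) : Type := E.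

HB.instance Definition _ (R : realType) (E : rieszType R)
    (archE : riesz_archimedean E) (u : E) (unit_u : riesz_unit u) :=
  Riesz.copy (hu_space archE unit_u) E.

HB.instance Definition _ (R : realType) (E : rieszType R)
    (archE : riesz_archimedean E) (u : E) (unit_u : riesz_unit u) :=
  isMetric.Build R (hu_space archE unit_u)
    (D_huxx archE unit_u) (D_hu_positivity archE unit_u)
    (@D_hu_sym R E u) (D_hu_triangle archE unit_u).

Section maxplus.
Context {R : realType} {E : rieszType R}.

(* Both iterated operations are idempotent and run over a nonempty index set,
   so taking the term of index 0 as initial value changes nothing. *)
Definition maxplus_hull (u : E) (S : set E) : set E :=
  [set y | exists (m : nat) (x : 'I_m.+1 -> E) (t : 'I_m.+1 -> R),
    [/\ forall i, S (x i),
        \big[Num.max/t ord0]_(i < m.+1) t i = 0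
      & y = \big[riesz_join/x ord0 + t ord0 *: u]_(i < m.+1)
              (x i + t i *: u)]].

Definition maxplus_convex (u : E) (C : set E) : Prop := C = maxplus_hull u C.

End maxplus.

(* Main.v *)
Require Import Defs.
From HB Require Import structures.
From mathcomp Require Import all_boot all_order all_algebra.
From mathcomp Require Import all_classical all_reals all_analysis.
From mathcomp Require Import wochoice lra.

(** The proof is Dugundji's, with joins in place of convex combinations.  Off A,
    points p of X carry weights w_p(x) that are continuous, at most 1, equal to
    1 for some p, locally finite, and positive only if p is much closer to x
    than A is.  Each p has an almost nearest point c(p) of A, and
<<
      fhat(x) = join over the p with w_p(x) > 0 of f(c(p)) + (1 - 1/w_p(x)) u
>>
    off A, while fhat = f on A.  The coefficients 1 - 1/w are at most 0 and one
    of them is 0, so fhat(x) lies in the hull.  A term whose weight tends to 0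
    has a coefficient tending to minus infinity and, u being a unit, sinks below
    the rest of the join before it disappears: this gives continuity off A
    ([maxplus_combination_continuous]).  Near a point a of A all the points
    c(p) that occur are near a, so fhat(x) is a join of shifts, by coefficients
    at most 0, of elements close to f(a), one of them unshifted; hence it is
    close to f(a).

    The weights ([max_partition_of_unity], [dugundji_weights]) replace the
    locally finite partitions of unity that paracompactness would give.  Start
    from the bumps g_p(x) = max(0, r_p - d(p,x)), which are 1-Lipschitz and
    bounded at each x, uniformly in p.  Well-order the indices and let the
    excess of p at x be the positive part of g_p(x) - sup_(q < p) g_q(x).  The
    first p with g_p(x) > 0 has positive excess.  On the other hand, the indices with excess
    greater than c at x have values g_p(x) that differ pairwise by more than c
    in a bounded interval, so they are finitely many.  As excesses are
    2-Lipschitz, keeping only the indices whose excess is more than half of the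
    largest one makes the family locally finite. *)

Set Implicit Arguments.
Unset Strict Implicit.
Unset Printing Implicit Defensive.

Import Order.TTheory GRing.Theory Num.Theory.
Import numFieldNormedType.Exports.

Local Open Scope classical_set_scope.
Local Open Scope ring_scope.

(** * Lipschitz functions and finite families *)

Section lipschitz.
Context {R : realType} {X : metricType R}.
Implicit Types (g : X -> R) (k : R).

Lemma near_mdist_lt (x : X) (e : R) : 0 < e -> \forall y \near x, mdist x y < e.
Proof. by move=> e0; apply/metricType_numDomainType.nbhs_mdistP; exists e. Qed.

(** One inequality is enough because x and y can be exchanged; this form passes
    directly to suprema. *)
Definition lipschitz_le k g := forall x y, g x <= g y + k * mdist x y.

Lemma lipschitz_le_continuous k g : 0 < k -> lipschitz_le k g -> continuous g.
Proof.
move=> k0 lg x; apply/cvgrPdist_lt => e e0.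
have := @near_mdist_lt x _ (divr_gt0 e0 k0).
apply: filterS => y; rewrite ltr_pdivlMr// mulrC => xy.
have := lg x y; have := lg y x; rewrite (metric_sym y x) => h1 h2.
by rewrite ltr_norml; apply/andP; split; lra.
Qed.

(** D may be empty: both suprema then take the default value 0. *)
Lemma lipschitz_le_sup (I : Type) (D : set I) (g : I -> X -> R) k : 0 <= k ->
  (forall i, lipschitz_le k (g i)) ->
  (forall x, exists M, forall i, g i x <= M) ->
  lipschitz_le k (fun x => sup [set g i x | i in D]).
Proof.
move=> k0 lg bg x y; have [->|/set0P[i Di]] := eqVneq D set0.
  by rewrite !image_set0 sup0 add0r mulr_ge0// mdist_ge0.
apply: ge_sup; first by exists (g i x), i.
move=> _ [j Dj <-]; apply: le_trans (lg j x y) _; rewrite lerD2r.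
apply: ub_le_sup; last by exists j.
by have [M gM] := bg y; exists M => _ [l _ <-].
Qed.

End lipschitz.

Lemma near_all_seq (T : Type) (F : set_system T) (FF : Filter F) (I : eqType)
    (s : seq I) (P : I -> T -> Prop) :
  (forall i, i \in s -> \forall x \near F, P i x) ->
  \forall x \near F, forall i, i \in s -> P i x.
Proof.
elim: s => [|i s IHs] Ps; first by apply: nearW.
have Pi : \forall x \near F, P i x by apply: Ps; rewrite mem_head.
have {}IHs : \forall x \near F, forall i, i \in s -> P i x.
  by apply: IHs => j js; apply: Ps; rewrite inE js orbT.
near=> x => j; rewrite inE => /predU1P[->|]; first by near: x.
by move: j; near: x.
Unshelve. all: by end_near. Qed.

Lemma seq_max (R : realType) (I : eqType) (F : I -> R) (s : seq I) i0 :
  i0 \in s -> exists2 i, i \in s & forall j, j \in s -> F j <= F i.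
Proof.
elim: s i0 => // i s IHs i0 _; have [->|[j js]] : s = [::] \/ exists j, j \in s.
- by case: s {IHs} => [|j s]; [left|right; exists j; rewrite mem_head].
- by exists i => [|j]; rewrite mem_seq1 // => /eqP ->.
have [m ms mmax] := IHs _ js.
have [Fim|Fmi] := leP (F i) (F m).
  by exists m => [|l]; rewrite inE ?ms ?orbT// => /predU1P[->|/mmax].
exists i => [|l]; rewrite inE ?eqxx// => /predU1P[->//|/mmax Flm].
exact: le_trans Flm (ltW Fmi).
Qed.

(** Truncating F / c to an integer is injective on D and takes boundedly many
    values. *)
Lemma separated_bounded_finite (R : realType) (I : Type) (D : set I)
    (F : I -> R) (c M : R) : 0 < c ->
  (forall i, D i -> 0 <= F i <= M) ->
  (forall i j, D i -> D j -> i <> j -> c < `|F i - F j|) -> finite_set D.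
Proof.
move=> c0 DM sepF; pose N := (Num.truncn (M / c)).+1.
have DN i : D i -> (Num.truncn (F i / c) < N)%N.
  move=> /DM/andP[_ FM]; rewrite /N ltnS; apply: le_truncn.
  by rewrite ler_pM2r ?invr_gt0.
have inj : {in D &, injective (fun i => Num.truncn (F i / c))}.
  move=> i j /set_mem Di /set_mem Dj eqt; apply: contrapT => ij.
  have := sepF _ _ Di Dj ij; apply/negP; rewrite -leNgt.
  have /andP[Fi0 _] := DM _ Di; have /andP[Fj0 _] := DM _ Dj.
  have Fic0 : 0 <= F i / c by rewrite divr_ge0// ltW.
  have Fjc0 : 0 <= F j / c by rewrite divr_ge0// ltW.
  have := truncn_itv Fic0; have := truncn_itv Fjc0; rewrite eqt.
  rewrite -natr1 !ler_pdivlMr// !ltr_pdivrMr//.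
  move=> /andP[a1 a2] /andP[b1 b2].
  by rewrite ler_norml; apply/andP; split; lra.
have := finite_II N; apply: card_le_finite.
rewrite -(card_le_eql (inj_card_eq inj)).
by apply: subset_card_le => _ [i Di <-]; exact: DN.
Qed.

(** * Max-normalised partitions of unity *)

Lemma strict_well_order (I : eqType) : exists lt : I -> I -> Prop,
  (forall i j, i <> j -> lt i j \/ lt j i) /\
  (forall D : set I, D !=set0 -> exists2 i, D i & forall j, lt j i -> ~ D j).
Proof.
have [r wor] := well_ordering_principle I.
have wor' : wo_chain r predT by apply: withinW.
exists (fun i j => r i j /\ i <> j); split=> [i j ij|D [i Di]].
  have /orP[rij|rji] := wo_chainW wor' (isT : i \in predT) (isT : j \in predT).
    by left.
  by right; split => //; exact/nesym.
have [|z [[zD zmin] _]] := wor (mem D); first by exists i; exact/mem_set.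
exists z; first exact: set_mem.
move=> j [rjz +] Dj; apply; apply: (wo_chain_antisymmetric wor') => //.
by rewrite rjz zmin//; exact/mem_set.
Qed.

Section max_partition.
Context {R : realType} {X : metricType R} {I : choiceType}.
Variables (lt : I -> I -> Prop) (g : I -> X -> R).
Hypothesis lt_total : forall i j, i <> j -> lt i j \/ lt j i.
Hypothesis lt_wf :
  forall D : set I, D !=set0 -> exists2 i, D i & forall j, lt j i -> ~ D j.
Hypothesis g_lip : forall i, lipschitz_le 1 (g i).
Hypothesis g_ge0 : forall i x, 0 <= g i x.
Hypothesis g_bounded : forall x, exists M, forall i, g i x <= M.

Definition excess i x : R :=
  Num.max 0 (g i x - sup [set g j x | j in [set j | lt j i]]).

Definition max_excess x : R := sup [set excess i x | i in setT].

(** Twice the excess is compared with the largest one, so that an index of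
    positive weight at y near x has an excess at x bounded away from 0, and an
    index of largest excess has weight 1. *)
Definition max_weight i x : R :=
  Num.max 0 (2 * excess i x / max_excess x - 1).

Let has_ubound_g (D : set I) x : has_ubound [set g j x | j in D].
Proof. by have [M gM] := g_bounded x; exists M => _ [j _ <-]. Qed.

Let pred_sup_ge0 i x : 0 <= sup [set g j x | j in [set j | lt j i]].
Proof.
have [->|/set0P[j ji]] := eqVneq [set j | lt j i] set0.
  by rewrite image_set0 sup0.
by apply: le_trans (g_ge0 j x) _; apply: ub_le_sup => //; exists j.
Qed.

Lemma excess_ge0 i x : 0 <= excess i x.
Proof. by rewrite /excess le_max lexx. Qed.

Lemma excess_le i x : excess i x <= g i x.
Proof. by rewrite /excess ge_max g_ge0/= gerBl. Qed.

Lemma excess_lipschitz i : lipschitz_le 2 (excess i).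
Proof.
move=> x y; rewrite /excess.
have gxy := g_lip i x y.
have hyx := @lipschitz_le_sup R X I [set j | lt j i] g 1 ler01 g_lip g_bounded
  y x.
rewrite /= (metric_sym y x) in hyx; have d0 := mdist_ge0 x y.
have [m0 my] : 0 <= Num.max 0 (g i y - sup [set g j y | j in [set j | lt j i]])
    /\ g i y - sup [set g j y | j in [set j | lt j i]] <=
    Num.max 0 (g i y - sup [set g j y | j in [set j | lt j i]]).
  by rewrite !le_max !lexx orbT.
by rewrite ge_max; apply/andP; split; lra.
Qed.

(** The bump of the later index exceeds that of the earlier one by at least the
    excess of the later index. *)
Lemma excess_separated i j x c : 0 <= c -> c < excess i x -> c < excess j x ->
  i <> j -> c < `|g i x - g j x|.
Proof.
move=> c0; wlog : i j / lt j i => [wlt ci cj ij|ji ci _ _].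
  have [ltij|ltji] := lt_total ij; last exact: wlt.
  by rewrite distrC; apply: wlt => //; exact/nesym.
move: ci; rewrite /excess lt_max ltNge c0/= => ci.
apply: lt_le_trans (ler_norm _); apply: lt_le_trans ci _.
by rewrite lerD2l lerN2; apply: ub_le_sup => //; exists j.
Qed.

Lemma finite_excess_gt x c : 0 < c -> finite_set [set i | c < excess i x].
Proof.
move=> c0; have [M gM] := g_bounded x.
apply: (@separated_bounded_finite _ _ _ (g^~ x) c M c0) => [i _|i j /= ci cj].
  by rewrite g_ge0 gM.
exact: excess_separated (ltW c0) ci cj.
Qed.

Let excess_bounded x : exists M, forall i, excess i x <= M.
Proof.
have [M gM] := g_bounded x; exists M => i.
by apply: le_trans (gM i); apply: excess_le.
Qed.

Lemma excess_le_max i x : excess i x <= max_excess x.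
Proof.
have [M eM] := excess_bounded x.
by apply: ub_le_sup; [exists M => _ [j _ <-]|exists i].
Qed.

Lemma max_excess_lipschitz : lipschitz_le 2 max_excess.
Proof. exact: lipschitz_le_sup excess_lipschitz excess_bounded. Qed.

(** At the first index whose bump is positive at x, all earlier bumps vanish. *)
Lemma max_excess_gt0 i x : 0 < g i x -> 0 < max_excess x.
Proof.
move=> gi; have [|j gj jmin] := @lt_wf [set j | 0 < g j x]; first by exists i.
apply: lt_le_trans (excess_le_max j x); rewrite /excess lt_max ltxx/= subr_gt0.
apply: le_lt_trans gj.
have [->|/set0P[k kj]] := eqVneq [set k | lt k j] set0.
  by rewrite image_set0 sup0.
apply: ge_sup; first by exists (g k x), k.
by move=> _ [l /jmin/negP + <-]; rewrite -leNgt.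
Qed.

(** Only finitely many indices have an excess above half of the supremum. *)
Lemma max_excess_attained x : 0 < max_excess x ->
  exists i, excess i x = max_excess x.
Proof.
move=> m0; have m20 : 0 < max_excess x / 2 by rewrite divr_gt0.
have /finite_seqP[s sE] := finite_excess_gt x m20.
have mem_s i : (max_excess x / 2 < excess i x) = (i \in s).
  by have /(congr1 (@^~ i)) := sE; rewrite /= => /= h; apply/idP/idP; rewrite h.
have values_neq0 : [set excess i x | i in setT] !=set0.
  apply/set0P/eqP => values0.
  by move: m0; rewrite /max_excess values0 sup0 ltxx.
have half_lt : max_excess x / 2 < max_excess x.
  by rewrite ltr_pdivrMr// ltr_pMr// ltr1n.
have [_ [i _ <-] ei] := sup_gt values_neq0 half_lt.
have [k ks kmax] := seq_max (fun i => excess i x) (etrans (esym (mem_s i)) ei).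
exists k; apply/le_anti; rewrite excess_le_max/=.
apply: ge_sup => // _ [j _ <-].
have [js|] := boolP (j \in s); first exact: kmax.
rewrite -mem_s; rewrite -leNgt => ej; apply: le_trans ej _.
by rewrite ltW// mem_s.
Qed.

Lemma max_weight_gt0 i x : 0 < max_excess x ->
  (0 < max_weight i x) = (max_excess x < 2 * excess i x).
Proof.
by move=> m0; rewrite /max_weight lt_max ltxx/= subr_gt0 ltr_pdivlMr// mul1r.
Qed.

Lemma max_weight_le1 i x : max_weight i x <= 1.
Proof.
rewrite /max_weight ge_max ler01/= lerBlDr.
have [m0|m0] := ltP 0 (max_excess x).
  by rewrite ler_pdivrMr// ler_wpM2l// excess_le_max.
have -> : excess i x = 0.
  by apply/le_anti; rewrite excess_ge0 (le_trans (excess_le_max i x)).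
by rewrite mulr0 mul0r addr_ge0.
Qed.

Lemma max_weight_continuous i x : 0 < max_excess x ->
  {for x, continuous (max_weight i)}.
Proof.
move=> m0.
have ce : {for x, continuous (excess i)}.
  exact: lipschitz_le_continuous (ltr0n _ 2) (excess_lipschitz i) x.
have cm : {for x, continuous max_excess}.
  exact: lipschitz_le_continuous (ltr0n _ 2) max_excess_lipschitz x.
apply: continuous_max; first exact: cst_continuous.
apply: cvgB; last exact: cvg_cst.
apply: cvgM; first by apply: cvgM => //; exact: cvg_cst.
by apply: cvgV => //; rewrite gt_eqF.
Qed.

(** If d(x,y) < m/8, where m is the largest excess at x, then an index of
    positive weight at y has an excess above (m - 2m/8)/2 at y, hence above m/8
    at x; finitely many indices have that. *)
Lemma max_weight_locally_finite x : 0 < max_excess x ->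
  exists s : seq I, \forall y \near x, forall i, 0 < max_weight i y -> i \in s.
Proof.
move=> m0; have m80 : 0 < max_excess x / 8 by rewrite divr_gt0.
have /finite_seqP[s sE] := finite_excess_gt x m80.
exists s; apply: filterS (near_mdist_lt x m80) => y xy i.
have mxy := max_excess_lipschitz x y; have exy := excess_lipschitz i y x.
rewrite (metric_sym y x) in exy.
rewrite max_weight_gt0; last by lra.
move=> ei; have /(congr1 (@^~ i)) /= <- := sE.
by lra.
Qed.

End max_partition.

(** A max-plus form of the paracompactness of metric spaces.  The continuity and
    local finiteness of w may fail where all the bumps g vanish. *)
Lemma max_partition_of_unity (R : realType) (X : metricType R) (I : choiceType)
    (g : I -> X -> R) :
  (forall i, lipschitz_le 1 (g i)) -> (forall i x, 0 <= g i x) ->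
  (forall x, exists M, forall i, g i x <= M) ->
  exists w : I -> X -> R, forall x, (exists i, 0 < g i x) ->
    [/\ forall i, w i x <= 1,
        exists i, w i x = 1,
        forall i, 0 < w i x -> 0 < g i x,
        forall i, {for x, continuous (w i)}
      & exists s : seq I, \forall y \near x, forall i, 0 < w i y -> i \in s].
Proof.
move=> g_lip g_ge0 g_bounded.
have [lt [lt_total lt_wf]] := strict_well_order I.
exists (max_weight lt g) => x [k gk].
have m0 := max_excess_gt0 lt_wf g_ge0 g_bounded gk.
split=> [i||i||].
- exact: max_weight_le1.
- have [i ei] := max_excess_attained lt_total g_ge0 g_bounded m0.
  exists i; have -> : max_weight lt g i x = Num.max 0 (2 - 1).
    by rewrite /max_weight ei mulfK// gt_eqF.
  have -> : 2 - 1 = 1 :> R by lra.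
  by apply/max_idPr.
- by have := excess_le lt g_ge0 g_bounded i x; rewrite max_weight_gt0//; lra.
- move=> i; exact: max_weight_continuous.
- exact: max_weight_locally_finite.
Qed.

(** The weight of p lives on the ball around p of radius d(p, c p) / 8.  If it
    is positive at x, then d(p,a) <= 4/3 d(x,a) for all a in A, and the almost
    minimality of d(p, c p) gives d(a, c p) <= 3 d(p,a) <= 4 d(x,a). *)
Lemma dugundji_weights (R : realType) (X : metricType R) (A : set X) :
  A !=set0 -> closed A ->
  exists (c : X -> X) (w : X -> X -> R), forall x, ~ A x ->
    [/\ forall p, w p x <= 1,
        exists p, w p x = 1,
        forall p, 0 < w p x ->
          A (c p) /\ forall a, A a -> mdist a (c p) <= 4 * mdist a x,
        forall p, {for x, continuous (w p)}
      & exists s : seq X, \forall y \near x, forall p, 0 < w p y -> p \in s].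
Proof.
move=> [a0 Aa0] clA.
have near_pt p : exists q, [/\ A q, forall a, A a -> mdist p q <= 2 * mdist p a
    & ~ A p -> 0 < mdist p q].
  have [Ap|nAp] := pselect (A p).
    by exists p; split=> // a _; rewrite mdistxx mulr_ge0// mdist_ge0.
  have [e e0 eA] : exists2 e, 0 < e & forall a, A a -> e <= mdist p a.
    have : \forall q \near p, ~ A q.
      by apply: open_nbhs_nbhs; split=> //; exact: closed_openC.
    move=> /metricType_numDomainType.nbhs_mdistP[e /= e0 eA].
    by exists e => // a Aa; rewrite leNgt; apply/negP => /eA.
  pose D := [set mdist p a | a in A].
  have D0 : D !=set0 by exists (mdist p a0), a0.
  have lbD : lbound D e by move=> _ [a Aa <-]; exact: eA.
  have infD : has_inf D by split => //; exists e.
  have eD : e <= inf D by apply: lb_le_inf.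
  (* The slack in the infimum is the infimum itself: hence the factor 2. *)
  have D20 : 0 < inf D by apply: lt_le_trans eD.
  have [_ [q Aq <-] qD] := inf_adherent D20 infD.
  exists q; split=> // [a Aa|_]; last by apply: lt_le_trans (eA _ Aq).
  have : inf D <= mdist p a by apply: ge_inf; [exact: infD.2|exists a].
  by lra.
have [c cP] := choice near_pt.
pose g (p x : X) : R := Num.max 0 (mdist p (c p) / 8 - mdist p x).
have g_gt0 p x : 0 < g p x -> mdist p x < mdist p (c p) / 8.
  by rewrite /g lt_max ltxx/= subr_gt0.
have g_lip p : lipschitz_le 1 (g p).
  move=> x y; rewrite /g mul1r ge_max addr_ge0 ?le_max ?lexx ?mdist_ge0//=.
  have : mdist p (c p) / 8 - mdist p y <=
      Num.max 0 (mdist p (c p) / 8 - mdist p y).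
    by rewrite le_max lexx orbT.
  by have := metric_triangle p x y; lra.
have g_ge0 p x : 0 <= g p x by rewrite le_max lexx.
have close p x a : A a -> 0 < g p x -> mdist p a <= 4 / 3 * mdist a x.
  move=> Aa /g_gt0 gpx; have [_ /(_ _ Aa) pc _] := cP p.
  have := metric_triangle p x a; rewrite (metric_sym x a); lra.
have g_bounded x : exists M, forall p, g p x <= M.
  exists (mdist a0 x) => p; have [gpx|] := ltP 0 (g p x); last first.
    by move=> gpx; apply: le_trans gpx (mdist_ge0 _ _).
  have := close _ _ _ Aa0 gpx; have [_ /(_ _ Aa0) pc _] := cP p.
  have := mdist_ge0 p x; have := mdist_ge0 a0 x.
  by rewrite /g ge_max => *; apply/andP; split; lra.
have [w wP] := max_partition_of_unity g_lip g_ge0 g_bounded.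
exists c, w => x nAx.
have [|w1 w_max w_supp w_cont w_fin] := wP x.
  exists x; rewrite /g mdistxx subr0 lt_max; apply/orP; right.
  by rewrite divr_gt0//; have [_ _ ->] := cP x.
split=> // p /w_supp gpx; have [Ac pc _] := cP p; split=> // a Aa.
have := close _ _ _ Aa gpx; have := pc _ Aa; have := metric_triangle a p (c p).
by rewrite (metric_sym a p); lra.
Qed.

(** * Riesz spaces and max-plus hulls *)

Section riesz.
Context {R : realType} {E : rieszType R}.
Implicit Types x y z u : E.

Lemma riesz_leD x y z w : x <= y -> z <= w -> x + z <= y + w.
Proof.
move=> xy zw; apply: le_trans (riesz_leD2r z xy) _.
by rewrite ![y + _]addrC; exact: riesz_leD2r.
Qed.

Lemma riesz_leBlD x y z : (x - y <= z) = (x <= y + z).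
Proof.
rewrite [y + z]addrC; apply/idP/idP => [/(riesz_leD2r y)|/(riesz_leD2r (- y))].
  by rewrite subrK.
by rewrite addrK.
Qed.

Lemma riesz_ler_scale u (s t : R) : 0 <= u -> s <= t -> s *: u <= t *: u.
Proof.
move=> u0 st; have : 0 <= (t - s) *: u by rewrite riesz_scaler_ge0 ?subr_ge0.
by move=> /(riesz_leD2r (s *: u)); rewrite add0r scalerBl subrK.
Qed.

Lemma riesz_leUl x y : x <= riesz_join x y.
Proof. by have := lexx (riesz_join x y); rewrite riesz_leUx => /andP[]. Qed.

Lemma riesz_leUr x y : y <= riesz_join x y.
Proof. by have := lexx (riesz_join x y); rewrite riesz_leUx => /andP[]. Qed.

Lemma riesz_unit_bound u x y :
  riesz_unit u -> exists n : nat, x <= y + n%:R *: u.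
Proof.
move=> [_ /(_ (riesz_join (x - y) 0) (riesz_leUr _ _))[n xn]]; exists n.
rewrite -riesz_leBlD scaler_nat; apply: le_trans xn; exact: riesz_leUl.
Qed.

Lemma riesz_big_joinP (n : nat) (F : 'I_n -> E) x0 z :
  \big[riesz_join/x0]_(i < n) F i <= z <-> x0 <= z /\ forall i, F i <= z.
Proof.
elim: n F => [|n IHn] F.
  by rewrite big_ord0; split=> [|[]//]; split=> // -[].
rewrite big_ord_recl riesz_leUx; split=> [/andP[F0 /IHn[x0z Fz]]|[x0z Fz]].
  by split=> // i; have [j ->|->//] := unliftP ord0 i.
by rewrite Fz/=; apply/IHn.
Qed.

(** A max-plus combination enters the sequel only through its upper bounds, so
    that neither the enumeration of the indices nor repetitions matter. *)
Lemma maxplus_hull_lub (I : eqType) (S : set E) u (s : seq I) (F : I -> E)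
    (t : I -> R) :
  (forall i, i \in s -> S (F i)) -> (forall i, i \in s -> t i <= 0) ->
  (exists2 i, i \in s & t i = 0) ->
  exists2 y, maxplus_hull u S y &
    forall z, y <= z <-> forall i, i \in s -> F i + t i *: u <= z.
Proof.
case: s => [|i0 s] SF t0 [k ks tk]; first by rewrite in_nil in ks.
pose e (j : 'I_(size s).+1) := nth i0 (i0 :: s) j.
have e_in j : e j \in i0 :: s by apply: mem_nth; exact: ltn_ord.
have e_onto i : i \in i0 :: s -> exists j, e j = i.
  by move=> /(nthP i0)[j js <-]; exists (Ordinal js).
exists (\big[riesz_join/F (e ord0) + t (e ord0) *: u]_(j < (size s).+1)
   (F (e j) + t (e j) *: u)).
  exists (size s), (F \o e), (t \o e); split=> [j||//]; first exact: SF.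
  apply/le_anti/andP; split; first by apply: bigmax_le => [|j _]; exact: t0.
  by have [j ej] := e_onto _ ks; rewrite -{1}tk -{1}ej; exact: le_bigmax.
move=> z; rewrite riesz_big_joinP; split=> [[_ Fz] i /e_onto[j <-]//|Fz].
by split=> [|j]; exact: Fz.
Qed.

Lemma maxplus_hull_sub (S : set E) u : S `<=` maxplus_hull u S.
Proof.
move=> x Sx; exists 0, (fun=> x), (fun=> 0).
rewrite !big_ord_recl !big_ord0 maxxx scale0r addr0; split=> //.
by apply/le_anti; rewrite riesz_leUl riesz_leUx lexx.
Qed.

Hypothesis archE : riesz_archimedean E.
Variable u : E.
Hypothesis unit_u : riesz_unit u.

(** The metric is handled through these two bounds, which lose a factor 2: it is
    the sum of the two one-sided distances, not their maximum. *)
Lemma D_hu_le x y (e : R) :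
  D_hu u x y <= e -> x <= y + e *: u /\ y <= x + e *: u.
Proof.
have D0 z : 0 <= Num.max 0 (p_u u z) by rewrite le_max lexx.
have le_of z : Num.max 0 (p_u u z) <= e -> z <= e *: u.
  by move=> ze; rewrite -(maxp_u_le archE)// (le_trans _ ze).
rewrite /D_hu => De; rewrite -!riesz_leBlD.
by split; apply: le_of; apply: le_trans De; [rewrite lerDl|rewrite lerDr].
Qed.

Lemma le_D_hu x y (e : R) :
  0 <= e -> x <= y + e *: u -> y <= x + e *: u -> D_hu u x y <= e + e.
Proof.
by move=> e0; rewrite -!riesz_leBlD => xy yx; rewrite /D_hu lerD// maxp_u_le.
Qed.

End riesz.

(** * Extension *)

Section combination_continuity.
Context {R : realType} {E : rieszType R}.
Hypothesis archE : riesz_archimedean E.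
Variable u : E.
Hypothesis unit_u : riesz_unit u.
Context {X : topologicalType} {I : eqType}.
Variables (b : I -> E) (w : I -> X -> R).

(** The least upper bound of the terms of positive weight, where the coefficient
    1 - 1/w runs from minus infinity (w = 0) to 0 (w = 1).  It is a relation, as
    joins of infinite families need not exist. *)
Definition is_maxplus_combination x (y : E) :=
  forall z, y <= z <-> forall i, 0 < w i x -> b i + (1 - (w i x)^-1) *: u <= z.

(** Near x0 only the indices in s matter.  Those of positive weight at x0 have
    coefficients continuous at x0; the others have coefficients so negative that
    their terms lie below F x0. *)
Lemma maxplus_combination_continuous (F : X -> hu_space archE unit_u)
    (s : seq I) x0 :
  (forall i, {for x0, continuous (w i)}) ->
  (\forall x \near x0, forall i, 0 < w i x -> i \in s) ->
  (\forall x \near x0, is_maxplus_combination x (F x)) ->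
  {for x0, continuous F}.
Proof.
move=> w_cont w_fin F_lub; apply/metricType_numDomainType.cvgrPdist_le => e e0.
have u0 := unit_u.1; have e20 : 0 < e / 2 by rewrite divr_gt0.
have F0 : is_maxplus_combination x0 (F x0) := nbhs_singleton F_lub.
have termF i : 0 < w i x0 -> b i + (1 - (w i x0)^-1) *: u <= F x0.
  by move: i; apply/F0; exact: lexx.
have inv_cont i : 0 < w i x0 -> {for x0, continuous (fun x => (w i x)^-1)}.
  by move=> wi; apply: cvgV; [rewrite gt_eqF|exact: w_cont].
have upper : \forall x \near x0, forall i, i \in s -> 0 < w i x ->
    b i + (1 - (w i x)^-1) *: u <= (F x0 : E) + (e / 2) *: u.
  apply: near_all_seq => i _; have [wi|wi] := ltP 0 (w i x0).
    have /cvgrPdist_lt/(_ _ e20) := inv_cont i wi.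
    apply: filterS => x; rewrite ltr_norml => /andP[we1 we2] _.
    apply: le_trans (riesz_leD2r ((e / 2) *: u) (termF i wi)).
    rewrite -addrA -scalerDl; apply: riesz_leD => //.
    by apply: riesz_ler_scale => //; lra.
  (* The weight of i vanishes at x0: once it is below 1/(n+1), the coefficient
     is below - n, where b i <= F x0 + n u. *)
  have [n bn] := riesz_unit_bound (b i) (F x0) unit_u.
  have n0 : 0 < (n.+1%:R : R)^-1 by rewrite invr_gt0.
  have : \forall x \near x0, w i x < n.+1%:R^-1.
    by apply: (cvgr_lt _ (w_cont i)); apply: le_lt_trans n0.
  apply: filterS => x wn wx.
  have nw : n.+1%:R < (w i x)^-1 by rewrite -[ltLHS]invrK ltf_pV2.
  rewrite -natr1 in nw.
  apply: le_trans (riesz_leD bn (lexx ((1 - (w i x)^-1) *: u))) _.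
  rewrite -addrA -scalerDl; apply: riesz_leD => //.
  by apply: riesz_ler_scale => //; lra.
have lower : \forall x \near x0, forall i, i \in s -> 0 < w i x0 ->
    0 < w i x /\ (w i x)^-1 <= (w i x0)^-1 + e / 2.
  apply: near_all_seq => i _; have [wi|wi] := ltP 0 (w i x0); last first.
    exact: nearW.
  have wx : \forall x \near x0, 0 < w i x by apply: (cvgr_gt _ (w_cont i)).
  have /cvgrPdist_lt/(_ _ e20) := inv_cont i wi.
  apply: filterS2 wx => x wx; rewrite ltr_norml => /andP[we1 we2] _.
  by split=> //; lra.
apply: filterS3 upper lower (filterI w_fin F_lub) => x up low [fin Fx].
rewrite [leRHS]splitr; apply: le_D_hu => //; first exact: ltW.
- apply/F0 => i wi.
  have [wix inv_le] := low i (nbhs_singleton w_fin i wi) wi.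
  have termx : b i + (1 - (w i x)^-1) *: u <= F x.
    by move: i wix {wi inv_le}; apply/Fx; exact: lexx.
  apply: le_trans (riesz_leD2r ((e / 2) *: u) termx).
  rewrite -addrA -scalerDl; apply: riesz_leD => //.
  by apply: riesz_ler_scale => //; lra.
- by apply/Fx => i wi; apply: up => //; exact: fin.
Qed.

End combination_continuity.

Theorem theorem5 (R : realType) (E : rieszType R)
    (E_neq0 : exists x : E, x != 0)
    (archE : riesz_archimedean E) (u : E) (unit_u : riesz_unit u)
    (X : metricType R) (A : set X) (A_neq0 : A !=set0) (A_closed : closed A)
    (C : set E) (C_neq0 : C !=set0) (C_convex : maxplus_convex u C)
    (f : X -> hu_space archE unit_u)
    (f_cont : {within A, continuous f}) (f_C : f @` A `<=` C) :
  exists fhat : X -> hu_space archE unit_u,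
    [/\ continuous fhat,
        forall x, maxplus_hull u (f @` A) (fhat x)
      & forall x, A x -> fhat x = f x].
Proof.
have [c [w cwP]] := dugundji_weights A_neq0 A_closed.
pose b p : E := f (c p).
have fhat_ex x : exists y : E, [/\ maxplus_hull u (f @` A) y, A x -> y = f x
    & ~ A x -> is_maxplus_combination u b w x y].
  have [Ax|nAx] := pselect (A x).
    by exists (f x); split=> //; apply: maxplus_hull_sub; exists x.
  have [w1 [k wk] w_near w_cont [s /nbhs_singleton sP]] := cwP x nAx.
  have [|||y hull_y y_lub] := @maxplus_hull_lub R E _ (f @` A) u
      [seq p <- s | 0 < w p x] b (fun p => 1 - (w p x)^-1).
  - move=> p; rewrite mem_filter => /andP[wp _].
    by exists (c p) => //; exact: (w_near p wp).1.
  - move=> p; rewrite mem_filter => /andP[wp _].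
    by rewrite subr_le0 invf_ge1.
  - have wk0 : 0 < w k x by rewrite wk.
    by exists k; rewrite ?wk ?invr1 ?subrr// mem_filter wk0 sP.
  exists y; split=> // _ z; apply: iff_trans (y_lub z) _; split=> yz p.
    by move=> wp; apply: yz; rewrite mem_filter wp sP.
  by rewrite mem_filter => /andP[wp _]; exact: yz.
have [fhat fhatP] := choice fhat_ex.
exists fhat; split=> x; [|by have [] := fhatP x|by have [_] := fhatP x].
have [Ax|nAx] := pselect (A x); last first.
  have [_ _ _ w_cont [s sP]] := cwP x nAx.
  apply: (maxplus_combination_continuous w_cont sP).
  have : \forall y \near x, ~ A y.
    by apply: open_nbhs_nbhs; split=> //; exact: closed_openC.
  by apply: filterS => y nAy; have [_ _] := fhatP y; exact.
apply/metricType_numDomainType.cvgrPdist_le => e e0.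
have e20 : 0 < e / 2 by rewrite divr_gt0.
have [_ /(_ Ax) -> _] := fhatP x.
(* Both continuity of f on A and the factor 4 of the weights enter here: the
   points c p that occur at y are within d of x as soon as y is within d / 4. *)
have [d d0 fd] : exists2 d, 0 < d & forall a, A a -> mdist x a < d ->
    D_hu u (f x) (f a) <= e / 2.
  have /metricType_numDomainType.cvgrPdist_le/(_ _ e20) :=
    (@subspace_continuousP _ A _ f).1 f_cont x Ax.
  rewrite near_withinE => /metricType_numDomainType.nbhs_mdistP[d /= d0 fd].
  by exists d => // a Aa xa; exact: fd.
have d40 : 0 < d / 4 by rewrite divr_gt0.
apply: filterS (near_mdist_lt x d40) => y xy.
rewrite [leRHS]splitr.
have [Ay|nAy] := pselect (A y).
  have [_ /(_ Ay) -> _] := fhatP y.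
  apply: (@le_trans _ _ (e / 2)); last by lra.
  by apply: fd => //; lra.
have [_ _ /(_ nAy) y_lub] := fhatP y.
have [w1 [k wk] w_near _ _] := cwP y nAy.
have close p : 0 < w p y ->
    (f x : E) <= b p + (e / 2) *: u /\ b p <= (f x : E) + (e / 2) *: u.
  move=> /w_near[Acp /(_ _ Ax) xcp]; apply: (D_hu_le archE unit_u).
  by apply: fd => //; lra.
apply: le_D_hu => //; first exact: ltW.
- have wk0 : 0 < w k y by rewrite wk.
  have : b k <= fhat y.
    have /(_ k wk0) := (y_lub (fhat y)).1 (lexx _).
    by rewrite wk invr1 subrr scale0r addr0.
  by move=> bk; apply: le_trans (close k wk0).1 _; exact: riesz_leD2r.
- apply/y_lub => p wp; apply: le_trans (close p wp).2.
  rewrite -[leRHS]addr0; apply: riesz_leD => //.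
  rewrite -(scale0r u); apply: riesz_ler_scale; first exact: unit_u.1.
  by rewrite subr_le0 invf_ge1.
Qed.
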